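(* Let $d\geq 2$. For every integer $m\geq 0$, every homogeneous polynomial $f_m$ of degree $m$ in $d$ variables $x_1,\dots,x_d$ (with complex coefficients), and each $j=1,\dots,d$, we have $$\left\langle x_j^2 f_m,f_m\right\rangle_{L^2(\mathbb{S}^{d-1})}\geq \frac{\pi^2}{4(m+2d+1)^2}\left\langle f_m,f_m\right\rangle_{L^2(\mathbb{S}^{d-1})}.$$
   Context: $\mathbb{S}^{d-1}=\{\theta\in\mathbb{R}^d:|\theta|=1\}$ is the unit sphere, with surface area measure $d\theta$, and the inner product is $$\langle f,g\rangle_{L^2(\mathbb{S}^{d-1})}=\int_{\mathbb{S}^{d-1}}f(\theta)\overline{g(\theta)}\,d\theta .$$ *)

(* Defs.v *)
(* [mpoly] has to be imported before MathComp-Analysis: in the other order   *)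
(* the parser rejects its notations.                                         *)
From HB Require Import structures.
From mathcomp Require Import all_boot all_order all_algebra.
From mathcomp Require Import mpoly.
From mathcomp Require Import complex.
From mathcomp Require Import all_classical all_reals all_analysis.
From mathcomp Require Import measurable_realfun.

Set Implicit Arguments.
Unset Strict Implicit.
Unset Printing Implicit Defensive.

Import Order.TTheory GRing.Theory Num.Theory.
Import numFieldNormedType.Exports.

Local Open Scope classical_set_scope.
Local Open Scope ring_scope.

Notation euclidean R d := (d.-tuple (measurableTypeR R)).

Section lebesgue_measure_euclidean.
Variable R : realType.

Definition cons_pair n (p : measurableTypeR R * euclidean R n) :
  euclidean R n.+1 := [tuple of p.1 :: p.2].

Lemma measurable_cons_pair n : measurable_fun [set: _] (@cons_pair n).
Proof. exact: measurable_cons. Qed.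

Section cons.
Variables (n : nat) (nu : {sigma_finite_measure set (euclidean R n) -> \bar R}).

Definition lebesgue_cons : set (euclidean R n.+1) -> \bar R :=
  pushforward (@lebesgue_measure R \x nu)%E (@cons_pair n).

Let mcons := @measurable_cons_pair n.

Let lebesgue_cons0 : lebesgue_cons set0 = 0%E.
Proof. exact: measure0. Qed.

Let lebesgue_cons_ge0 A : (0 <= lebesgue_cons A)%E.
Proof. exact: measure_ge0. Qed.

Let lebesgue_cons_sigma_additive : semi_sigma_additive lebesgue_cons.
Proof. exact: measure_semi_sigma_additive. Qed.

HB.instance Definition _ := isMeasure.Build _ _ _ lebesgue_cons
  lebesgue_cons0 lebesgue_cons_ge0 lebesgue_cons_sigma_additive.

Let lebesgue_cons_sigma_finite : sigma_finite setT lebesgue_cons.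
Proof.
pose uncons (x : euclidean R n.+1) : measurableTypeR R * euclidean R n :=
  (thead x, [tuple of behead x]).
have consK : cancel (@cons_pair n) uncons.
  by move=> [a t]; congr pair; exact/val_inj.
have muncons : measurable_fun [set: _] uncons.
  apply: measurable_fun_pair; first exact: measurable_tnth.
  exact: measurable_behead.
have /sigma_finiteP[F [TF ndF Foo]] := sigma_finiteT (@lebesgue_measure R).
have /sigma_finiteP[G [TG ndG Goo]] := sigma_finiteT nu.
exists (fun k => uncons @^-1` (F k `*` G k)).
  rewrite -preimage_bigcup; suff -> : \bigcup_k (F k `*` G k) = setT by [].
  apply/seteqP; split=> // -[a t] _.
  have [i _ Fi] : (\bigcup_i F i) a by rewrite -TF.
  have [k _ Gk] : (\bigcup_i G i) t by rewrite -TG.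
  exists (maxn i k) => //; split.
    by move: Fi; exact/subsetPset/ndF/leq_maxl.
  by move: Gk; exact/subsetPset/ndG/leq_maxr.
move=> k; have [mF Fk] := Foo k; have [mG Gk] := Goo k.
have mFG := measurableX mF mG; split.
  by rewrite -[X in measurable X]setTI; exact: muncons.
rewrite /lebesgue_cons /pushforward -comp_preimage.
have -> : uncons \o @cons_pair n = id by apply/funext => p; exact: consK.
by rewrite preimage_id product_measure1E// lte_mul_pinfty// ge0_fin_numE.
Qed.

HB.instance Definition _ := Measure_isSigmaFinite.Build _ _ _ lebesgue_cons
  lebesgue_cons_sigma_finite.

End cons.

Fixpoint lebesgue_euclidean n :
    {sigma_finite_measure set (euclidean R n) -> \bar R} :=
  if n is n'.+1 then lebesgue_cons (lebesgue_euclidean n') else \d_ [tuple].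

Lemma lebesgue_euclidean_box n (A : 'I_n -> set (measurableTypeR R)) :
  (forall i, measurable (A i)) ->
  (lebesgue_euclidean n [set x | forall i, A i (tnth x i)] =
   \prod_(i < n) lebesgue_measure (A i))%E.
Proof.
elim: n => [|n IHn] in A * => mA.
  by rewrite big_ord0 /= diracE mem_set// => -[].
rewrite big_ord_recl -IHn// -product_measure1E//; last first.
  rewrite (_ : mkset _ = \bigcap_(i : 'I_n)
      ((fun x : euclidean R n => tnth x i) @^-1` A (lift ord0 i))); last first.
    by apply/seteqP; split => x /= xA i; [move=> _|]; exact: xA.
  apply: fin_bigcap_measurable => // i _.
  by rewrite -[X in measurable X]setTI; exact: measurable_tnth.
rewrite /= /lebesgue_cons /pushforward; congr (product_measure1 _ _ _).
apply/seteqP; split => -[a t] /=.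
  move=> aA; split=> [|i]; first exact: (aA ord0).
  by have := aA (lift ord0 i); rewrite /cons_pair/= tnthS.
move=> [aA tA] i; case: (unliftP ord0 i) => [k ->|-> //].
by rewrite /cons_pair/= tnthS; exact: tA.
Qed.

End lebesgue_measure_euclidean.

Section sphere.
Variables (R : realType) (d : nat).

Definition eucl_norm (x : euclidean R d) : R :=
  Num.sqrt (\sum_(i < d) tnth x i ^+ 2).

Definition sphere : set (euclidean R d) := [set x | eucl_norm x = 1].

Definition punctured_ball : set (euclidean R d) :=
  [set x | 0 < eucl_norm x <= 1].

Definition radial_proj (x : euclidean R d) : euclidean R d :=
  [tuple tnth x i / eucl_norm x | i < d].

Lemma measurable_eucl_norm : measurable_fun [set: _] eucl_norm.
Proof.
apply: (@measurableT_comp _ _ _ _ _ _ (@Num.sqrt R)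
  _ (fun x : euclidean R d => \sum_(i < d) tnth x i ^+ 2)).
  by apply: continuous_measurable_fun; exact: sqrt_continuous.
apply: measurable_sum => i; apply: measurable_funX; exact: measurable_tnth.
Qed.

Lemma measurable_punctured_ball : measurable punctured_ball.
Proof.
rewrite -[X in measurable X]setTI.
rewrite (_ : _ `&` _ = [set: _] `&` eucl_norm @^-1` `]0, 1]); last first.
  by congr (_ `&` _); apply/funext => x /=; rewrite in_itv.
exact: measurable_eucl_norm.
Qed.

Lemma measurable_radial_proj : measurable_fun [set: _] radial_proj.
Proof.
apply/measurable_fun_tnthP => i.
rewrite (_ : _ \o _ = fun x => tnth x i * (eucl_norm x `^ (-1))); last first.
  by apply/funext => x /=; rewrite tnth_mktuple powR_inv1// sqrtr_ge0.
apply: measurable_funM; first exact: measurable_tnth.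
apply: (measurableT_comp (measurable_powR _)).
exact: measurable_eucl_norm.
Qed.

(* Cone measure: a subset [A] of the sphere has d times the Lebesgue measure *)
(* of {r *: theta | 0 < r <= 1, theta in A}. This is the polar-coordinates   *)
(* normalisation, dx = r^(d-1) dr dtheta, of total mass d * vol(unit ball).  *)
Definition surface_measure (A : set (euclidean R d)) : \bar R :=
  (d%:R%:E *
   lebesgue_euclidean R d (radial_proj @^-1` A `&` punctured_ball))%E.

Definition cone_measure : {measure set (euclidean R d) -> \bar R} :=
  mscale (d%:R%:nng : {nonneg R})
    (measure_function_pushforward__canonical__measure_function_Measure
      (mrestr (lebesgue_euclidean R d) measurable_punctured_ball)
      measurable_radial_proj).

Let surface_measure0 : surface_measure set0 = 0%E.
Proof. exact: (measure0 cone_measure). Qed.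

Let surface_measure_ge0 A : (0 <= surface_measure A)%E.
Proof. exact: (measure_ge0 cone_measure). Qed.

Let surface_measure_sigma_additive : semi_sigma_additive surface_measure.
Proof. exact: (@measure_semi_sigma_additive _ _ _ cone_measure). Qed.

HB.instance Definition _ := isMeasure.Build _ _ _ surface_measure
  surface_measure0 surface_measure_ge0 surface_measure_sigma_additive.

End sphere.

Section inner_product.
Variables (R : realType) (d : nat).
Local Open Scope complex_scope.

Definition sphere_integral (h : euclidean R d -> R[i]) : R[i] :=
  Complex (\int[@surface_measure R d]_(x in @sphere R d) complex.Re (h x))
          (\int[@surface_measure R d]_(x in @sphere R d) complex.Im (h x)).

Definition sphere_inner (f g : euclidean R d -> R[i]) : R[i] :=
  sphere_integral (fun x => f x * (g x)^*).

Definition poly_fun (p : {mpoly R[i][d]}) (x : euclidean R d) : R[i] :=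
  p.@[fun i => (tnth x i)%:C].

End inner_product.

(* Main.v *)
Require Import Defs.
From mathcomp Require Import all_boot all_order all_algebra.
From mathcomp Require Import perm.
From mathcomp Require Import mpoly.
From mathcomp Require Import complex.
From mathcomp Require Import all_classical all_reals all_analysis.
From mathcomp Require Import measurable_realfun.
From mathcomp Require Import ring lra zify.
From Stdlib Require Import Lia.

(** Put [u = |f|^2].  A half circle through the poles [e_j] and [- e_j] and a
unit vector [w] orthogonal to them is [t |-> sin t e_j + cos t w].  On it [u] is
a nonnegative trigonometric polynomial of degree [2m], whose frequencies are all
even, and [x_j^2] is [sin^2 t].  In these coordinates the surface measure is
[cos^(d-2) t dt dw] ([polar_slicing]), so a lower bound for [sin^2] against each
[u cos^(d-2)] is enough.

For even [d] the weight is itself a trigonometric polynomial.  The functions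
[u cos^(d-2)] and [u cos^(d-2) sin^2] have degree less than [2K] for
[K = m + d/2 + 1], so that their integral over a half turn is exactly [pi/K]
times the sum of their values at [K] points with spacing [pi/K]
([integral_trig_poly_atan]).  For the points [pi/(2K) + k pi/K] the factor
[sin^2] is everywhere at least [sin^2 (pi/(2K))], whence the inequality with
this constant ([integral_sin2_atan], [even_coordinate_bound]).

For odd [d] the form is seen as one in [d+1] variables.  Slicing along the dummy
variable shows that its two integrals over the larger sphere are those over
the original one, multiplied by the integrals of two powers of the cosine.  The
power is higher for the integral of [x_j^2 u], so its factor is smaller, and the
inequality descends ([odd_coordinate_bound]).

In all cases [K + 3 <= m + 2d + 1], which leaves enough room for
[sin (pi/(2K)) >= pi / (2(m+2d+1))] ([sin_first_node]).

Since the surface measure is a cone measure, integrals over a sphere are handled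
as Lebesgue integrals of [phi (|x|) * u (x/|x|)] for a radial profile [phi]; the
slicing formula then only needs Fubini's theorem and dilations. *)

Set Implicit Arguments.
Unset Strict Implicit.
Unset Printing Implicit Defensive.
Import Order.TTheory GRing.Theory Num.Theory.
Import numFieldNormedType.Exports.
Local Open Scope ring_scope.

(** * Trigonometric polynomials *)

Section trigonometric_polynomials.
Variable R : realType.
Implicit Types (A B : R -> R) (x : R).

(** Trigonometric polynomials whose frequencies are at most the index and have
its parity: the restrictions to the unit circle of forms of that degree.  The
parity is what makes those of even degree [pi]-periodic. *)
Inductive trig_poly : nat -> (R -> R) -> Prop :=
| trig_cos l k : trig_poly (l + k.*2) (fun x => cos (l%:R * x))
| trig_sin l k : trig_poly (l + k.*2) (fun x => sin (l%:R * x))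
| trig_add m A B : trig_poly m A -> trig_poly m B ->
    trig_poly m (fun x => A x + B x)
| trig_scale m c A : trig_poly m A -> trig_poly m (fun x => c * A x).

Lemma eq_trig m A B : A =1 B -> trig_poly m A -> trig_poly m B.
Proof. by move=> /funext ->. Qed.

Lemma trig_cst c : trig_poly 0 (fun=> c).
Proof.
have := trig_scale c (trig_cos 0 0).
by congr trig_poly; apply/funext => x; rewrite mul0r cos0 mulr1.
Qed.

Lemma trig_zero m : trig_poly m (fun=> 0).
Proof.
have := trig_scale 0 (trig_cos m 0).
by rewrite addn0; congr trig_poly; apply/funext => x; rewrite mul0r.
Qed.

Lemma trig_sum m (I : Type) (r : seq I) (P : pred I) (A : I -> R -> R) :
  (forall i, P i -> trig_poly m (A i)) ->
  trig_poly m (fun x => \sum_(i <- r | P i) A i x).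
Proof.
move=> hA; elim: r => [|i r IH].
  by apply: eq_trig (trig_zero m) => x; rewrite big_nil.
case: (boolP (P i)) => Pi; last first.
  by apply: eq_trig IH => x; rewrite big_cons (negPf Pi).
by apply: eq_trig (trig_add (hA i Pi) IH) => x; rewrite big_cons Pi.
Qed.

(** The product formulas turn a product of modes of frequencies [b <= a] into
modes of frequencies [a - b] and [a + b], which have the same parity. *)
Lemma trig_mul_modes (p q : bool) a b k :
  let f (p : bool) := if p then @cos R else @sin R in
  trig_poly (a + b + k.*2) (fun x => f p (a%:R * x) * f q (b%:R * x)).
Proof.
move=> f.
wlog ab : p q a b / (b <= a)%N => [H|].
  have [/H|/ltnW/H] := leqP b a; first exact.
  move=> /(_ q p); rewrite (addnC b); congr trig_poly.
  by apply/funext => x; rewrite mulrC.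
have e : (a + b + k.*2 = a - b + (b + k).*2)%N. by lia.
have tp g : trig_poly (a + b + k.*2) (fun x => f g ((a%:R + b%:R) * x)).
  rewrite -natrD; case: g; [exact: trig_cos|exact: trig_sin].
have tm g : trig_poly (a + b + k.*2) (fun x => f g ((a%:R - b%:R) * x)).
  rewrite e -natrB//; case: g; [exact: trig_cos|exact: trig_sin].
have comb g c c' : trig_poly (a + b + k.*2)
    (fun x => c * f g ((a%:R + b%:R) * x) + c' * f g ((a%:R - b%:R) * x)).
  by apply: trig_add; apply: trig_scale.
case: p; case: q.
- have := comb true (1/2) (1/2); congr trig_poly; apply/funext => x /=.
  by rewrite mulrDl mulrBl cosD cosB; field.
- have := comb false (1/2) (-(1/2)); congr trig_poly; apply/funext => x /=.
  by rewrite mulrDl mulrBl sinD sinB; field.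
- have := comb false (1/2) (1/2); congr trig_poly; apply/funext => x /=.
  by rewrite mulrDl mulrBl sinD sinB; field.
- have := comb true (-(1/2)) (1/2); congr trig_poly; apply/funext => x /=.
  by rewrite mulrDl mulrBl cosD cosB; field.
Qed.

Lemma trig_mul a b A B : trig_poly a A -> trig_poly b B ->
  trig_poly (a + b) (fun x => A x * B x).
Proof.
have main (p : bool) l k c C : trig_poly c C ->
    trig_poly (l + k.*2 + c)
      (fun x => (if p then @cos R else @sin R) (l%:R * x) * C x).
  elim=> [l' k'|l' k'|m D E _ HD _ HE|m c' D _ HD].
  - have := trig_mul_modes p true l l' (k + k').
    by congr trig_poly; rewrite doubleD addnACA.
  - have := trig_mul_modes p false l l' (k + k').
    by congr trig_poly; rewrite doubleD addnACA.
  - by apply: eq_trig (trig_add HD HE) => x; rewrite mulrDr.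
  - by apply: eq_trig (trig_scale c' HD) => x; rewrite mulrCA.
move=> tA tB; elim: tA => [l k|l k|m C D _ HC _ HD|m c C _ HC].
- exact: (main true).
- exact: (main false).
- by apply: eq_trig (trig_add HC HD) => x; rewrite mulrDl.
- by apply: eq_trig (trig_scale c HC) => x; rewrite mulrA.
Qed.

Lemma trig_prod (I : Type) (r : seq I) (m : I -> nat) (A : I -> R -> R) :
  (forall i, trig_poly (m i) (A i)) ->
  trig_poly (\sum_(i <- r) m i) (fun x => \prod_(i <- r) A i x).
Proof.
move=> tA; elim: r => [|i r IH].
  by rewrite big_nil; apply: eq_trig (trig_cst 1) => x; rewrite big_nil.
by rewrite big_cons; apply: eq_trig (trig_mul (tA i) IH) => x; rewrite big_cons.
Qed.

Lemma trig_exp a n A : trig_poly a A -> trig_poly (a * n) (fun x => A x ^+ n).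
Proof.
move=> tA; elim: n => [|n IH]; first by rewrite muln0; exact: trig_cst.
by rewrite mulnS; apply: eq_trig (trig_mul tA IH) => x; rewrite exprS.
Qed.

Lemma trig_sin1 : trig_poly 1 (@sin R).
Proof.
have := trig_sin 1 0; congr trig_poly.
by apply/funext => x; rewrite mul1r.
Qed.

Lemma trig_cos1 : trig_poly 1 (@cos R).
Proof.
have := trig_cos 1 0; congr trig_poly.
by apply/funext => x; rewrite mul1r.
Qed.

Lemma continuous_trig m A : trig_poly m A -> continuous A.
Proof.
elim=> [l k|l k|n B C _ cB _ cC|n c B _ cB] x.
- apply: (@continuous_comp _ _ _ (fun x => l%:R * x) cos).
    exact: mulrl_continuous.
  exact: continuous_cos.
- apply: (@continuous_comp _ _ _ (fun x => l%:R * x) sin).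
    exact: mulrl_continuous.
  exact: continuous_sin.
- by apply: continuousD; [exact: cB|exact: cC].
- by apply: continuousM; [exact: cst_continuous|exact: cB].
Qed.

(** Multiplied by twice the sine of the half step, the sum telescopes, and its
two ends differ by [l] full turns. *)
Lemma sum_equispaced_modes (l K : nat) x : (0 < l < K)%N ->
  \sum_(k < K) cos (l.*2%:R * (x + pi / K%:R * k%:R)) = 0 /\
  \sum_(k < K) sin (l.*2%:R * (x + pi / K%:R * k%:R)) = 0.
Proof.
move=> /andP[l0 lK].
have K0 : 0 < K%:R :> R by rewrite ltr0n (leq_trans _ lK).
pose b : R := l%:R * pi / K%:R.
have sb : sin b != 0.
  apply/lt0r_neq0/sin_gt0_pi; rewrite /b divr_gt0 ?mulr_gt0 ?pi_gt0 ?(ltr0n _ l)//=.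
  by rewrite ltr_pdivrMr// mulrC ltr_pM2l ?pi_gt0// ltr_nat.
pose g (k : nat) : R := l.*2%:R * x + (k.*2%:R - 1) * b.
have gK : g K = g 0%N + pi *+ 2 *+ l.
  rewrite /g /b -!muln2 !natrM -(mulr_natl _ l) -(mulr_natl _ 2).
  by field; rewrite gt_eqF.
have step k : g k.+1 = g k + 2 * b.
  by rewrite /g doubleS -[in LHS]natr1 -natr1; ring.
have mid k : l.*2%:R * (x + pi / K%:R * k%:R) = g k + b.
  rewrite /g /b -!muln2 !natrM; field; by rewrite gt_eqF.
have s2 : 2 * sin b != 0 by rewrite mulf_neq0// pnatr_eq0.
split; apply: (mulfI s2); rewrite mulr0.
  transitivity (\sum_(0 <= k < K) (sin (g k.+1) - sin (g k))).
    rewrite big_mkord mulr_sumr; apply: eq_bigr => k _.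
    rewrite step mid; set y := g k + b.
    have -> : g k + 2 * b = y + b by rewrite /y; ring.
    have -> : g k = y - b by rewrite /y addrK.
    by rewrite sinB sinD; ring.
  by rewrite telescope_sumr// gK (periodicn (@sinD2pi R)) subrr.
transitivity (\sum_(0 <= k < K) (cos (g k) - cos (g k.+1))).
  rewrite big_mkord mulr_sumr; apply: eq_bigr => k _.
  rewrite step mid; set y := g k + b.
  have -> : g k + 2 * b = y + b by rewrite /y; ring.
  have -> : g k = y - b by rewrite /y addrK.
  by rewrite cosB cosD; ring.
rewrite -[LHS]opprK -sumrN; under eq_bigr do rewrite opprB.
by rewrite telescope_sumr// gK (periodicn (@cosD2pi R)) subrr oppr0.
Qed.

End trigonometric_polynomials.

(** * Equally spaced quadrature *)

Section quadrature.
Variable R : realType.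
Implicit Types (A B : R -> R) (x : R).

Lemma is_derive_sin_mode (l : R) x :
  is_derive x 1 (fun x => sin (l * x)) (l * cos (l * x)).
Proof.
have h : is_derive x 1 (fun x => l * x) l.
  by apply: is_derive_eq; rewrite /GRing.scale/=; ring.
rewrite mulrC; exact: (is_derive1_comp (is_derive_sin _) h).
Qed.

Lemma is_derive_cos_mode (l : R) x :
  is_derive x 1 (fun x => cos (l * x)) (- (l * sin (l * x))).
Proof.
have h : is_derive x 1 (fun x => l * x) l.
  by apply: is_derive_eq; rewrite /GRing.scale/=; ring.
rewrite mulrC -mulNr; exact: (is_derive1_comp (is_derive_cos _) h).
Qed.

(** Equally spaced sums and the integral over a half turn both annihilate the
modes of frequency [2l] for [0 < l < K], so both only see the constant term.  The
integral enters through a primitive [F], which is what the fundamental theorem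
of calculus needs. *)
Lemma trig_poly_mean M K A : trig_poly M.*2 A -> (M < K)%N ->
  exists a0 (F : R -> R),
  [/\ forall x, \sum_(k < K) A (x + pi / K%:R * k%:R) = K%:R * a0,
      forall x, is_derive x 1 F (A x) &
      F (pi / 2) - F (- (pi / 2)) = pi * a0].
Proof.
move e : M.*2 => n tA MK; elim: tA e => [l k|l k|m B C _ HB _ HC|m c B _ HB] e.
- have [j jM lj] : exists2 j, (j <= M)%N & l = j.*2.
    by exists (M - k)%N; lia.
  case: (posnP j) lj => [->|j0] ->.
    exists 1, id; split=> [x|x|]; last by field.
    + under eq_bigr do rewrite mul0r cos0.
      by rewrite sumr_const card_ord mulr1.
    + by rewrite mul0r cos0; exact: is_derive_id.
  have j2 : j.*2%:R != 0 :> R by rewrite pnatr_eq0; lia.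
  exists 0, (fun x => j.*2%:R^-1 * sin (j.*2%:R * x)); split=> [x|x|].
  + rewrite mulr0; apply: (proj1 (sum_equispaced_modes x _)).
    by rewrite j0 (leq_ltn_trans jM).
  + have := is_derive_sin_mode j.*2%:R x => h.
    apply: is_derive_eq; by rewrite /GRing.scale/= mulrA mulVf// mul1r.
  + have -> : j.*2%:R * (pi / 2) = 0 + pi *+ j :> R.
      by rewrite -muln2 natrM -(mulr_natl _ j); field.
    rewrite mulrN sinN.
    have -> : j.*2%:R * (pi / 2) = 0 + pi *+ j :> R.
      by rewrite -muln2 natrM -(mulr_natl _ j); field.
    by rewrite (alternatingn (@sinDpi R)) sin0 !(mulr0, oppr0, addr0).
- have [j jM lj] : exists2 j, (j <= M)%N & l = j.*2.
    by exists (M - k)%N; lia.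
  case: (posnP j) lj => [->|j0] ->.
    exists 0, (cst 0); split=> [x|x|]; last by rewrite mulr0 subrr.
    + under eq_bigr do rewrite mul0r sin0.
      by rewrite mulr0 big1.
    + by rewrite mul0r sin0; exact: is_derive_cst.
  have j2 : j.*2%:R != 0 :> R by rewrite pnatr_eq0; lia.
  exists 0, (fun x => - j.*2%:R^-1 * cos (j.*2%:R * x)); split=> [x|x|].
  + rewrite mulr0; apply: (proj2 (sum_equispaced_modes x _)).
    by rewrite j0 (leq_ltn_trans jM).
  + have := is_derive_cos_mode j.*2%:R x => h.
    by apply: is_derive_eq; rewrite /GRing.scale/= mulrNN mulrA mulVf// mul1r.
  + by rewrite mulrN cosN subrr mulr0.
- have [b [F [sB dF iF]]] := HB e; have [c [G [sC dG iG]]] := HC e.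
  exists (b + c), (fun x => F x + G x); split=> [x|x|].
  + by rewrite big_split/= sB sC mulrDr.
  + exact: is_deriveD.
  + by rewrite mulrDr -iF -iG; ring.
- have [b [F [sB dF iF]]] := HB e.
  exists (c * b), (fun x => c * F x); split=> [x|x|].
  + by rewrite -mulr_sumr sB mulrCA.
  + exact: is_deriveZ.
  + by rewrite -mulrBr iF mulrCA.
Qed.

Let mu := @lebesgue_measure R.

(** [F \o atan] is a primitive of the integrand and tends to [F (pi / 2)] at
infinity. *)
Lemma integral0y_atan A F : (forall x, 0 <= A x) -> continuous A ->
  (forall x, is_derive x 1 F (A x)) ->
  (\int[mu]_(x in `[0%R, +oo[) (A (atan x) / (1 + x ^+ 2))%:E =
   (F (pi / 2) - F 0)%:E)%E.
Proof.
move=> A0 cA dF.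
have cF : continuous F.
  by move=> x; apply/differentiable_continuous/derivable1_diffP; exact: ex_derive.
have cf : continuous (fun x => A (atan x) / (1 + x ^+ 2)).
  move=> x; apply: cvgM; last exact: continuous_oneDsqrV.
  by apply: (@continuous_comp _ _ _ atan A); [exact: continuous_atan|exact: cA].
have dFa x : is_derive x 1 (F \o atan) (A (atan x) / (1 + x ^+ 2)).
  exact: is_derive1_comp.
rewrite (@ge0_continuous_FTC2y _ _ (F \o atan) 0 (F (pi / 2))).
- by rewrite /= atan0.
- by move=> x _; rewrite divr_ge0// addr_ge0// sqr_ge0.
- exact: continuous_subspaceT.
- apply: continuous_cvg; [exact: cF|exact: cvgy_atan].
- by move=> x _; exact: ex_derive.
- apply: cvg_at_right_filter.
  by apply: (@continuous_comp _ _ _ atan F); [exact: continuous_atan|exact: cF].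
- by move=> x _; rewrite derive1E; exact: derive_val.
Qed.

(** Exactness of the quadrature with [K] equally spaced nodes.  The circle is
parametrised by the slope [tan t], which is how it appears when a sphere is
sliced; since the mean of [A] over translates of the nodes is constant, the
nodes may start at [pi / (2 * K)]. *)
Lemma integral_trig_poly_atan M K A : (M < K)%N -> trig_poly M.*2 A ->
  (forall x, 0 <= A x) ->
  (\int[mu]_x (A (atan x) / (1 + x ^+ 2))%:E =
   (pi / K%:R *
    \sum_(k < K) A (pi / (2 * K%:R) + pi / K%:R * k%:R))%:E)%E.
Proof.
move=> MK tA A0.
have [a0 [F [sA dF iF]]] := trig_poly_mean tA MK.
have cA := continuous_trig tA.
have cf : continuous (fun x => A (atan x) / (1 + x ^+ 2)).
  move=> x; apply: cvgM; last exact: continuous_oneDsqrV.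
  by apply: (@continuous_comp _ _ _ atan A); [exact: continuous_atan|exact: cA].
have mf : measurable_fun setT (fun x => A (atan x) / (1 + x ^+ 2)).
  exact: continuous_measurable_fun.
have f0 x : 0 <= A (atan x) / (1 + x ^+ 2).
  by rewrite divr_ge0// addr_ge0// sqr_ge0.
have -> : [set: R]%classic = (`]-oo, (- 0)%R[ `|` `[0%R, +oo[)%classic.
  apply/seteqP; split=> // x _ /=; rewrite !in_itv/= oppr0 andbT.
  by case: (ltP x 0) => _; [left|right].
rewrite ge0_integral_setU//=; last 3 first.
- by apply/measurable_funTS/measurable_EFinP.
- by move=> x _; rewrite lee_fin.
- apply/disj_setPS => x/= [] /[!in_itv]/=; rewrite andbT oppr0.
  by move=> /lt_le_trans/[apply]; rewrite ltxx.
rewrite integral_itv_bndo_bndc; last exact/measurable_funTS/measurable_EFinP.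
rewrite ge0_integration_by_substitutionNy//; last exact: continuous_subspaceT.
rewrite (@integral0y_atan A F)//.
rewrite (_ : (fun x => _) = fun x => (A (- atan x) / (1 + x ^+ 2))%:E); last first.
  by apply/funext => x/=; rewrite atanN sqrrN.
have dG x : is_derive x 1 (fun x => - F (- x)) (A (- x)).
  have h : is_derive x 1 (F \o -%R) (A (- x) * - 1) by exact: is_derive1_comp.
  by apply: is_derive_eq; rewrite mulrN1 opprK.
have cAN : continuous (fun x => A (- x)).
  move=> x; apply: (@continuous_comp _ _ _ -%R A); last exact: cA.
  exact: opp_continuous.
rewrite (integral0y_atan (fun x => A0 (- x)) cAN dG) -EFinD sA oppr0.
have K0 : K%:R != 0 :> R by rewrite pnatr_eq0; lia.
by congr EFin; rewrite mulrA divfK// -iF; ring.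
Qed.

End quadrature.

Section nodes.
Local Open Scope classical_set_scope.
Variable R : realType.
Implicit Types (A : R -> R) (x : R).
Let mu := @lebesgue_measure R.

Lemma sin_le x : 0 <= x -> sin x <= x.
Proof.
rewrite le_eqVlt => /predU1P[<-|x0]; first by rewrite sin0.
have cs : {within `[0, x]%classic, continuous (@sin R)}.
  by apply: continuous_subspaceT => y; exact: continuous_sin.
have [c _ e] := MVT x0 (fun y _ => is_derive_sin y) cs.
move: e; rewrite sin0 !subr0 => ->.
by rewrite ler_piMl ?(ltW x0)// cos_le1.
Qed.

Lemma cos_ge x : 0 <= x -> 1 - x ^+ 2 / 2 <= cos x.
Proof.
move=> x0; have -> : x = x / 2 + x / 2 by field.
rewrite cosD -!expr2 cos2sin2.
have h0 : 0 <= x / 2 by rewrite divr_ge0.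
have hs : sin (x / 2) ^+ 2 <= (x / 2) ^+ 2.
  rewrite -[leLHS]real_normK ?num_real// ler_sqr ?nnegrE//.
  rewrite ler_norml; apply/andP; split; last exact: sin_le.
  have [xpi|pix] := leP (x / 2) pi.
    by apply: (@le_trans _ _ 0); [rewrite oppr_le0|rewrite sin_ge0_pi// h0].
  apply: (@le_trans _ _ (-1)); last exact: sin_geN1.
  rewrite lerN2 (le_trans _ (ltW pix))// (le_trans _ (pi_ge2 R))// ler1n//.
nra.
Qed.

Lemma sin_ge x : 0 <= x <= pi / 2 -> x * (1 - x ^+ 2 / 2) <= sin x.
Proof.
move=> /andP[]; rewrite le_eqVlt => /predU1P[<-|x0 xpi].
  by rewrite sin0 mul0r.
have cs : {within `[0, x]%classic, continuous (@sin R)}.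
  by apply: continuous_subspaceT => y; exact: continuous_sin.
have [c + e] := MVT x0 (fun y _ => is_derive_sin y) cs.
rewrite in_itv/= => /andP[c0 cx].
move: e; rewrite sin0 !subr0 => ->.
rewrite mulrC ler_pM2r// (le_trans _ (cos_ge (ltW c0)))//.
by rewrite lerD2l lerN2 ler_pM2r ?invr_gt0// ler_sqr ?nnegrE ?ltW.
Qed.

(** The slack [K + 3 <= N] absorbs the defect of [sin x <= x]: with [pi < 4] and
[sin x >= x * (1 - x ^+ 2 / 2)] the claim reduces to
[K ^+ 3 <= (K + 3) * (K ^+ 2 - 2)]. *)
Lemma sin_first_node (K N : nat) : (2 <= K)%N -> (K + 3 <= N)%N ->
  pi / (2 * N%:R) <= sin (pi / (2 * K%:R)) :> R.
Proof.
move=> K2 KN.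
have K2r : 2 <= K%:R :> R by rewrite ler_nat.
have KNr : K%:R + 3 <= N%:R :> R by rewrite -natrD ler_nat.
have p0 := pi_gt0 R; have p4 : pi < 4 :> R by have := pihalf_lt2 R; lra.
have k0 : 0 < K%:R :> R by lra.
have n0 : 0 < N%:R :> R by lra.
have x0 : 0 < pi / (2 * K%:R) :> R by rewrite divr_gt0// mulr_gt0.
apply: le_trans (sin_ge _); last first.
  rewrite ltW//= ler_pM2l// lef_pV2 ?posrE ?mulr_gt0//; lra.
rewrite [leRHS](_ : _ =
    pi / (2 * K%:R ^+ 3) * (K%:R ^+ 2 - pi ^+ 2 / 8)); last by field; lra.
apply: (@le_trans _ _ (pi / (2 * (K%:R + 3)))).
  by rewrite ler_pM2l// lef_pV2 ?posrE ?mulr_gt0//; lra.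
rewrite -subr_ge0 [leRHS](_ : _ = pi / (2 * K%:R ^+ 3 * (K%:R + 3)) *
    ((K%:R + 3) * (K%:R ^+ 2 - pi ^+ 2 / 8) - K%:R ^+ 3)); last by field; lra.
apply: mulr_ge0; first by rewrite divr_ge0 ?pi_ge0// mulr_ge0//; lra.
have pi2 : pi ^+ 2 / 8 <= 2 :> R by nra.
nra.
Qed.

(** The nodes fill [[pi / (2 * K), pi - pi / (2 * K)]], where the sine is
smallest at the two ends. *)
Lemma sin2_node K k : (k < K)%N ->
  sin (pi / (2 * K%:R)) ^+ 2 <= sin (pi / (2 * K%:R) + pi / K%:R * k%:R) ^+ 2 :> R.
Proof.
move=> kK; have p0 := pi_gt0 R.
have k0 : 0 < K%:R :> R by rewrite ltr0n; lia.
pose h : R := pi / (2 * K%:R).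
have h0 : 0 < h by rewrite divr_gt0// mulr_gt0.
have -> : pi / K%:R * k%:R = h * (2 * k%:R) by rewrite /h; field; lra.
rewrite -/h.
have hpi : h * (2 * K%:R) = pi by rewrite /h; field; lra.
have hle : h <= pi / 2.
  have K1 : 1 <= K%:R :> R by rewrite ler1n; lia.
  by rewrite -hpi [leRHS](_ : _ = h * K%:R) ?ler_peMr ?(ltW h0)//; field.
have kr : k%:R + 1 <= K%:R :> R by rewrite natr1 ler_nat.
have kr0 : 0 <= k%:R :> R by [].
have s0 : 0 <= sin h by rewrite sin_ge0_pi//; lra.
have mono y : h <= y <= pi / 2 -> sin h <= sin y.
  move=> /andP[hy ypi]; rewrite leNgt ltr_sin ?in_itv/= -?leNgt//; lra.
suff : sin h <= sin (h + h * (2 * k%:R)).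
  by move=> ss; rewrite ler_sqr ?nnegrE// (le_trans s0).
have [le|lt] := leP (h + h * (2 * k%:R)) (pi / 2).
  by apply: mono; rewrite le andbT lerDl mulr_ge0 ?(ltW h0)// mulr_ge0.
have hk : h <= h * (2 * K%:R - 1 - 2 * k%:R) by rewrite ler_peMr ?(ltW h0)//; lra.
(* Past the quarter turn, the sine is read off at the supplementary angle. *)
rewrite -[leRHS]opprK -sinN -sinDpi.
by apply: mono; apply/andP; split; rewrite -?hpi; lra.
Qed.

(** Both integrands are trigonometric polynomials of degree less than [2 * K],
so both integrals are the same positive combination of values at the nodes, and
there [sin ^+ 2] is bounded below.  This is where the constant of the theorem
comes from.  It is optimal for [K = M.+2], because of the square of a polynomial
that vanishes at all nodes but the two extreme ones. *)
Lemma integral_sin2_atan M K A : (M.+1 < K)%N -> trig_poly M.*2 A ->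
  (forall x, 0 <= A x) ->
  ((sin (pi / (2 * K%:R)) ^+ 2)%:E *
     \int[mu]_x (A (atan x) / (1 + x ^+ 2))%:E <=
   \int[mu]_x (sin (atan x) ^+ 2 * A (atan x) / (1 + x ^+ 2))%:E)%E.
Proof.
move=> MK tA A0.
have tsA : trig_poly M.+1.*2 (fun x => sin x ^+ 2 * A x).
  by apply: (trig_mul (trig_exp 2 (@trig_sin1 R)) tA).
have sA0 x : 0 <= sin x ^+ 2 * A x by rewrite mulr_ge0// sqr_ge0.
rewrite (integral_trig_poly_atan (ltnW MK) tA A0).
rewrite (integral_trig_poly_atan MK tsA sA0) -EFinM lee_fin.
rewrite mulrCA ler_wpM2l ?divr_ge0 ?pi_ge0// mulr_sumr.
by apply: ler_sum => k _; rewrite ler_wpM2r// sin2_node.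
Qed.

End nodes.

(** * Lebesgue measure under linear maps *)

Section lebesgue_euclidean_invariance.
Local Open Scope classical_set_scope.
Variable R : realType.
Let mu := @lebesgue_measure R.

Definition box n (A : 'I_n -> set (measurableTypeR R)) : set (euclidean R n) :=
  [set x | forall i, A i (tnth x i)].

Lemma measurable_box n (A : 'I_n -> set (measurableTypeR R)) :
  (forall i, measurable (A i)) -> measurable (box A).
Proof.
move=> mA; rewrite (_ : box A =
    \bigcap_(i : 'I_n) ((fun x : euclidean R n => tnth x i) @^-1` (A i))).
  apply: fin_bigcap_measurable => // i _.
  by rewrite -[X in measurable X]setTI; exact: measurable_tnth.
by apply/seteqP; split => x /= xA i; [move=> _|]; exact: xA.
Qed.

(** Boxes with measurable sides form a pi-system that generates the product
sigma-algebra. *)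
Lemma lebesgue_euclidean_unique n (m : {measure set (euclidean R n) -> \bar R}) :
  (forall A : 'I_n -> set (measurableTypeR R), (forall i, measurable (A i)) ->
    m (box A) = (\prod_(i < n) mu (A i))%E) ->
  forall X, measurable X -> lebesgue_euclidean R n X = m X.
Proof.
move=> mE X mX.
pose G := [set B | exists2 A : 'I_n -> set (measurableTypeR R),
  (forall i, measurable (A i)) & B = box A].
pose g k : set (euclidean R n) :=
  box (fun=> `[- k%:R, k%:R]%classic : set (measurableTypeR R)).
apply: (measure_unique G g) => //.
- apply/seteqP; split; last first.
    apply: smallest_sub; first exact: sigma_algebra_measurable.
    by move=> _ [A mA ->]; exact: measurable_box.
  apply: smallest_sub; first exact: smallest_sigma_algebra.
  rewrite -bigcup_seq; apply: bigcup_sub => i _ _ [B mB <-].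
  apply: sub_sigma_algebra; rewrite setTI.
  exists (fun j => if j == i then B else setT).
    by move=> j; case: ifP.
  apply/seteqP; split=> [x Bx j|x /(_ i)]; last by rewrite eqxx.
  by case: eqP => // ->.
- move=> _ _ [A mA ->] [B mB ->]; exists (fun i => A i `&` B i).
    by move=> i; exact: measurableI.
  by apply/seteqP; split=> [x [xA xB] i|x xAB]; [split|split=> i; case: (xAB i)].
- by move=> k; exists (fun=> `[- k%:R, k%:R]%classic).
- apply/seteqP; split=> // x _.
  pose M := \sum_(i < n) `|tnth x i|.
  exists (Num.truncn M).+1 => // i /=; rewrite in_itv/= -ler_norml.
  apply: le_trans (ltW (truncnS_gt _)).
  by rewrite /M (bigD1 i)//= lerDl sumr_ge0.
- by move=> _ [A mA ->]; rewrite mE//; exact: lebesgue_euclidean_box.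
- move=> k; rewrite [X in (X < _)%E]lebesgue_euclidean_box//.
  rewrite ltey_eq; apply/orP; left.
  apply: (big_ind (fun x : \bar R => x \is a fin_num)) => [//|a b|i _].
    exact: fin_numM.
  by rewrite /= lebesgue_measure_itv/=; case: ifP.
Qed.

(** Change of variables for a map that multiplies measures by a constant: all
the linear substitutions below, and the passage to a product, are instances. *)
Lemma ge0_integral_image_measure d1 d2 (X : measurableType d1) (Y : measurableType d2)
    (m1 : {measure set X -> \bar R}) (m2 : {measure set Y -> \bar R})
    (phi : X -> Y) (mphi : measurable_fun setT phi) (k : {nonneg R})
    (f : Y -> \bar R) :
  (forall A, measurable A -> m2 A = (k%:num%:E * m1 (phi @^-1` A))%E) ->
  measurable_fun setT f -> (forall x, 0 <= f x)%E ->
  (\int[m2]_x f x = k%:num%:E * \int[m1]_x f (phi x))%E.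
Proof.
move=> m12 mf f0.
pose p := measure_function_pushforward__canonical__measure_function_Measure m1 mphi.
rewrite (@eq_measure_integral _ _ _ _ (mscale k p)); last first.
  by move=> A mA _; rewrite m12.
by rewrite ge0_integral_mscale// ge0_integral_pushforward.
Qed.

Lemma lebesgue_measure_scale (r : {nonneg R}) (A : set (measurableTypeR R)) :
  0 < r%:num -> measurable A ->
  mu A = (r%:num%:E * mu ((fun x => r%:num * x)%R @^-1` A))%E.
Proof.
move=> r0 mA.
have mr : measurable_fun [set: measurableTypeR R]
    (fun x : measurableTypeR R => r%:num * x : measurableTypeR R).
  exact: mulrl_measurable.
pose p := measure_function_pushforward__canonical__measure_function_Measure mu mr.
apply: (lebesgue_measure_unique (mu := mscale r p)) => // _ [[a b] _ <-] /=.
rewrite /mscale/= /pushforward.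
rewrite (_ : _ @^-1` _ = `]r%:num^-1 * a, r%:num^-1 * b]%classic); last first.
  apply/seteqP; split=> x /=; rewrite !in_itv/=;
    by rewrite ltr_pdivrMl// ler_pdivlMl.
rewrite !lebesgue_measure_itv/= !lte_fin ltr_pM2l ?invr_gt0//.
case: ifPn => _; last by rewrite mule0.
by rewrite -EFinB -EFinM -mulrBr mulVKf// gt_eqF.
Qed.

Lemma ge0_integral_lebesgue_scale (r : R) (f : R -> \bar R) : 0 < r ->
  measurable_fun setT f -> (forall x, 0 <= f x)%E ->
  (\int[mu]_x f x = r%:E * \int[mu]_x f (r * x)%R)%E.
Proof.
move=> r0 mf f0; pose k := NngNum (ltW r0).
have mr : measurable_fun [set: measurableTypeR R]
    (fun x : measurableTypeR R => r * x : measurableTypeR R).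
  exact: mulrl_measurable.
apply: (ge0_integral_image_measure mr (k := k)) => // A mA.
exact: (@lebesgue_measure_scale k).
Qed.

Definition eucl_scale n (r : R) (x : euclidean R n) : euclidean R n :=
  [tuple r * tnth x i | i < n].

Lemma measurable_eucl_scale n r : measurable_fun setT (@eucl_scale n r).
Proof.
apply/measurable_fun_tnthP => i.
rewrite (_ : _ \o _ = fun x => r * tnth x i); last first.
  by apply/funext => x /=; rewrite tnth_mktuple.
by apply: measurable_funM => //; exact: measurable_tnth.
Qed.

Lemma ge0_integral_eucl_scale n (r : R) (f : euclidean R n -> \bar R) : 0 < r ->
  measurable_fun setT f -> (forall x, 0 <= f x)%E ->
  (\int[lebesgue_euclidean R n]_x f x =
   (r ^+ n)%:E * \int[lebesgue_euclidean R n]_x f (eucl_scale r x))%E.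
Proof.
move=> r0 mf f0; pose k := NngNum (exprn_ge0 n (ltW r0)).
have ms := @measurable_eucl_scale n r.
apply: (ge0_integral_image_measure ms (k := k)) => // A mA.
pose p := measure_function_pushforward__canonical__measure_function_Measure
  (lebesgue_euclidean R n) ms.
apply: (@lebesgue_euclidean_unique _ (mscale k p)) => // {}A {}mA.
rewrite -[LHS]/((r ^+ n)%:E *
  lebesgue_euclidean R n (eucl_scale r @^-1` box A))%E.
rewrite (_ : _ @^-1` _ = box (fun i => (fun x => r * x) @^-1` A i)); last first.
  by apply/seteqP; split=> x /= xA i; have := xA i; rewrite tnth_mktuple.
rewrite [X in (_ * X)%E]lebesgue_euclidean_box; last first.
  move=> i; rewrite -[X in measurable X]setTI.
  by apply: (@mulrl_measurable R setT r) => //; exact: mA.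
have -> : r ^+ n = \prod_(i < n) r by rewrite prodr_const card_ord.
rewrite -prodEFin -big_split/=; apply: eq_bigr => i _.
by rewrite (@lebesgue_measure_scale (NngNum (ltW r0))).
Qed.

Definition eucl_perm n (s : {perm 'I_n}) (x : euclidean R n) : euclidean R n :=
  [tuple tnth x (s i) | i < n].

Lemma measurable_eucl_perm n s : measurable_fun setT (@eucl_perm n s).
Proof.
apply/measurable_fun_tnthP => i.
rewrite (_ : _ \o _ = fun x => tnth x (s i)); last first.
  by apply/funext => x /=; rewrite tnth_mktuple.
exact: measurable_tnth.
Qed.

Lemma ge0_integral_eucl_perm n (s : {perm 'I_n}) (f : euclidean R n -> \bar R) :
  measurable_fun setT f -> (forall x, 0 <= f x)%E ->
  (\int[lebesgue_euclidean R n]_x f x =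
   \int[lebesgue_euclidean R n]_x f (eucl_perm s x))%E.
Proof.
move=> mf f0; rewrite -[RHS]mul1e.
have ms := @measurable_eucl_perm n s.
apply: (ge0_integral_image_measure ms (k := 1%:nng)) => // A mA.
rewrite mul1e.
pose p := measure_function_pushforward__canonical__measure_function_Measure
  (lebesgue_euclidean R n) ms.
apply: (@lebesgue_euclidean_unique _ p) => // {}A {}mA.
rewrite -[LHS]/(lebesgue_euclidean R n (eucl_perm s @^-1` box A)).
rewrite (_ : _ @^-1` _ = box (fun i => A (s^-1 i)%g)); last first.
  apply/seteqP; split=> x /= xA i; last first.
    by have := xA (s i); rewrite tnth_mktuple permK.
  by have := xA (s^-1 i)%g; rewrite tnth_mktuple permKV.
rewrite [LHS]lebesgue_euclidean_box//.
by rewrite (reindex_inj (@perm_inj _ s))/=; apply: eq_bigr => i _; rewrite permK.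
Qed.

Lemma ge0_integral_cons n (f : euclidean R n.+1 -> \bar R) :
  measurable_fun setT f -> (forall x, 0 <= f x)%E ->
  (\int[lebesgue_euclidean R n.+1]_x f x =
   \int[lebesgue_euclidean R n]_y \int[mu]_t f [tuple of t :: y])%E.
Proof.
move=> mf f0.
have mc := @measurable_cons_pair R n.
have h A : measurable A -> lebesgue_euclidean R n.+1 A =
   ((1%:nng : {nonneg R})%:num%:E *
    (mu \x lebesgue_euclidean R n)%E (@cons_pair R n @^-1` A))%E.
  by move=> mA; rewrite mul1e.
rewrite (ge0_integral_image_measure mc h mf f0) mul1e.
rewrite [LHS](fubini_tonelli2 (f \o @cons_pair R n))//.
exact: (measurableT_comp mf mc).
by move=> x; exact: f0.
Qed.

Lemma lebesgue_euclidean_origin n :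
  lebesgue_euclidean R n.+1 [set x | eucl_norm x = 0] = 0%E.
Proof.
rewrite (_ : [set x | _] = box (fun=> [set 0])); last first.
  apply/seteqP; split=> x /=.
    move/eqP; rewrite sqrtr_eq0 => x0 i.
    have /eqP : \sum_(i < n.+1) tnth x i ^+ 2 = 0.
      by apply/eqP; rewrite eq_le x0 sumr_ge0// => j _; exact: sqr_ge0.
    rewrite psumr_eq0; last by move=> j _; exact: sqr_ge0.
    by move=> /allP/(_ i); rewrite mem_index_enum sqrf_eq0/= => /(_ isT)/eqP.
  move=> x0; rewrite /eucl_norm big1 ?sqrtr0// => i _.
  by rewrite x0 expr0n.
rewrite [LHS]lebesgue_euclidean_box//.
by rewrite big_ord_recl lebesgue_measure_set1 mul0e.
Qed.

End lebesgue_euclidean_invariance.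

(** * Slicing of cones and spheres *)

Section slicing.
Local Open Scope classical_set_scope.
Variable R : realType.
Let mu := @lebesgue_measure R.

Lemma cos_atan_gt0 (x : R) : 0 < cos (atan x).
Proof. by rewrite cos_gt0_pihalf// atan_gtNpi2 atan_ltpi2. Qed.

Lemma sin_atan (x : R) : sin (atan x) = x * cos (atan x).
Proof. by rewrite -{2}(atanK x) /tan divfK// gt_eqF// cos_atan_gt0. Qed.

Lemma cos2_atan (x : R) : cos (atan x) ^+ 2 = (1 + x ^+ 2)^-1.
Proof. by rewrite cos_atan exprVn sqr_sqrtr// addr_ge0// sqr_ge0. Qed.

Lemma eucl_norm_ge0 n (x : euclidean R n) : 0 <= eucl_norm x.
Proof. exact: sqrtr_ge0. Qed.

Lemma sqr_eucl_norm n (x : euclidean R n) :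
  eucl_norm x ^+ 2 = \sum_(i < n) tnth x i ^+ 2.
Proof. by rewrite sqr_sqrtr// sumr_ge0// => i _; exact: sqr_ge0. Qed.

Lemma eucl_norm_eq n (x : euclidean R n) (r : R) : 0 <= r ->
  \sum_(i < n) tnth x i ^+ 2 = r ^+ 2 -> eucl_norm x = r.
Proof. by move=> r0 e; rewrite /eucl_norm e sqrtr_sqr ger0_norm. Qed.

Lemma eucl_norm_scale n (r : R) (x : euclidean R n) : 0 <= r ->
  eucl_norm (eucl_scale r x) = r * eucl_norm x.
Proof.
move=> r0; apply: eucl_norm_eq; first by rewrite mulr_ge0// eucl_norm_ge0.
rewrite exprMn sqr_eucl_norm mulr_sumr; apply: eq_bigr => i _.
by rewrite tnth_mktuple exprMn.
Qed.

(** The circle through the first basis vector and [w]; for [w] on the unit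
sphere it parametrises the points of the next sphere above [w]. *)
Definition slice n (a : R) (w : euclidean R n) : euclidean R n.+1 :=
  [tuple of sin a :: eucl_scale (cos a) w].

(** Choosing the first coordinate proportional to the norm of the others makes
the direction depend only on the slope [t] and on the direction of [y], and the
factor [cos (atan t)] restores the norm of [y]. *)
Lemma slice_polar n (t : R) (y : euclidean R n) : 0 < eucl_norm y ->
  let c := cos (atan t) in
  let x := [tuple of t * eucl_norm (eucl_scale c y) :: eucl_scale c y] in
  eucl_norm x = eucl_norm y /\ radial_proj x = slice (atan t) (radial_proj y).
Proof.
move=> y0 c x; have c0 := cos_atan_gt0 t.
have nx : eucl_norm x = eucl_norm y.
  apply: eucl_norm_eq; first exact: ltW.
  rewrite big_ord_recl tnth0.
  under eq_bigr do rewrite tnthS.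
  rewrite -sqr_eucl_norm eucl_norm_scale ?(ltW c0)//.
  have cc : (1 + t ^+ 2) * c ^+ 2 = 1.
    by rewrite cos2_atan mulfV// gt_eqF// ltr_pwDl// sqr_ge0.
  by rewrite -[RHS]mul1r -cc; ring.
split=> //; apply: eq_from_tnth => i; rewrite tnth_mktuple nx.
case: (unliftP ord0 i) => [k ->|->].
  by rewrite !tnthS !tnth_mktuple mulrA.
rewrite !tnth0 eucl_norm_scale ?(ltW c0)// sin_atan -/c mulrA mulfK//.
by rewrite gt_eqF.
Qed.

Lemma measurable_slice n : measurable_fun [set: R * euclidean R n]
  (fun z => slice (atan z.1) (radial_proj z.2)).
Proof.
have mat : measurable_fun [set: R] (@atan R).
  by apply: continuous_measurable_fun; exact: continuous_atan.
apply: measurable_cons.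
  apply: (measurableT_comp (f := @sin R)).
    by apply: continuous_measurable_fun; exact: continuous_sin.
  exact: measurableT_comp.
apply/measurable_fun_tnthP => i.
rewrite (_ : _ \o _ = fun z : R * euclidean R n =>
    cos (atan z.1) * tnth (radial_proj z.2) i); last first.
  by apply/funext => z /=; rewrite tnth_mktuple.
apply: measurable_funM.
  apply: (measurableT_comp (f := @cos R)).
    by apply: continuous_measurable_fun; exact: continuous_cos.
  exact: measurableT_comp.
apply: (measurableT_comp (measurable_tnth i)).
by apply: (measurableT_comp (@measurable_radial_proj R n)).
Qed.

Lemma measurable_slice_integrand n p (u : euclidean R n.+1 -> R) :
  measurable_fun setT u -> measurable_fun [set: R * euclidean R n]
    (fun z => cos (atan z.1) ^+ p * u (slice (atan z.1) (radial_proj z.2))).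
Proof.
move=> mU; apply: measurable_funM.
  apply: measurable_funX.
  apply: (measurableT_comp (f := @cos R)).
    by apply: continuous_measurable_fun; exact: continuous_cos.
  apply: (measurableT_comp (f := @atan R)) => //.
  by apply: continuous_measurable_fun; exact: continuous_atan.
exact: (measurableT_comp mU (@measurable_slice n)).
Qed.

Lemma measurable_slice_integral n p (u : euclidean R n.+1 -> R) :
  measurable_fun setT u -> (forall x, 0 <= u x) ->
  measurable_fun setT (fun y : euclidean R n =>
    \int[mu]_t (cos (atan t) ^+ p * u (slice (atan t) (radial_proj y)))%:E)%E.
Proof.
move=> mU u0.
pose F (z : R * euclidean R n) :=
  (cos (atan z.1) ^+ p * u (slice (atan z.1) (radial_proj z.2)))%:E.
have mF : measurable_fun setT F.
  by apply/measurable_EFinP; exact: measurable_slice_integrand.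
apply: (measurable_fun_fubini_tonelli_G (m1 := mu) F mF) => z.
by rewrite lee_fin mulr_ge0// exprn_ge0// ltW// cos_atan_gt0.
Qed.

(** Slicing of a sphere into the half circles that join its two poles, in the
form needed for cones.  Fubini separates the first coordinate from [y]; the
substitution [t * |y|] for the first coordinate, then [cos (atan t) * y] for
[y], lead to the points of [slice_polar].  The Jacobian of the two dilations is
[|y|] times a power of [cos (atan t)].  The radial profile [phi] is arbitrary
because slicing multiplies it by the radius. *)
Lemma polar_slicing n (phi : R -> R) (u : euclidean R n.+2 -> R) :
  measurable_fun setT phi -> (forall r, 0 <= phi r) ->
  measurable_fun setT u -> (forall x, 0 <= u x) ->
  (\int[lebesgue_euclidean R n.+2]_x (phi (eucl_norm x) * u (radial_proj x))%:E
   = \int[lebesgue_euclidean R n.+1]_y ((eucl_norm y * phi (eucl_norm y))%:E *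
      \int[mu]_t (cos (atan t) ^+ n.+2 *
                  u (slice (atan t) (radial_proj y)))%:E))%E.
Proof.
move=> mphi phi0 mU u0.
pose H (x : euclidean R n.+2) := phi (eucl_norm x) * u (radial_proj x).
have H0 x : 0 <= H x by rewrite mulr_ge0.
have mH : measurable_fun setT H.
  apply: measurable_funM.
    exact: (measurableT_comp mphi (@measurable_eucl_norm R n.+2)).
  exact: (measurableT_comp mU (@measurable_radial_proj R n.+2)).
have mN : measurable_fun [set: R * euclidean R n.+1] (fun z => eucl_norm z.2).
  by apply: (measurableT_comp (@measurable_eucl_norm R n.+1)).
pose F1 (z : R * euclidean R n.+1) := (H [tuple of z.1 :: z.2])%:E.
pose F2 (z : R * euclidean R n.+1) :=
  (eucl_norm z.2 * H [tuple of z.1 * eucl_norm z.2 :: z.2])%:E.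
pose F3 (z : R * euclidean R n.+1) :=
  (eucl_norm z.2 * phi (eucl_norm z.2) *
   (cos (atan z.1) ^+ n.+2 * u (slice (atan z.1) (radial_proj z.2))))%:E.
have mF1 : measurable_fun setT F1.
  apply/measurable_EFinP; apply: (measurableT_comp mH).
  exact: measurable_cons.
have mF2 : measurable_fun setT F2.
  apply/measurable_EFinP; apply: measurable_funM => //.
  apply: (measurableT_comp mH).
  apply: measurable_cons => //.
  by apply: measurable_funM.
have mG := measurable_slice_integrand n.+2 mU.
have mF3 : measurable_fun setT F3.
  apply/measurable_EFinP; apply: measurable_funM => //.
  apply: measurable_funM => //.
  exact: (measurableT_comp mphi mN).
have F10 z : (0 <= F1 z)%E by rewrite lee_fin.
have F20 z : (0 <= F2 z)%E by rewrite lee_fin mulr_ge0// eucl_norm_ge0.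
have c0 t := ltW (@cos_atan_gt0 t).
have F30 z : (0 <= F3 z)%E.
  rewrite lee_fin; apply: mulr_ge0; apply: mulr_ge0 => //.
    exact: eucl_norm_ge0.
  exact: exprn_ge0.
transitivity (\int[lebesgue_euclidean R n.+1]_y \int[mu]_t F1 (t, y))%E.
  by rewrite ge0_integral_cons//; exact/measurable_EFinP.
transitivity (\int[lebesgue_euclidean R n.+1]_y \int[mu]_t F2 (t, y))%E.
  (* [t * eucl_norm y] is a change of variable away from the origin only. *)
  apply: ge0_ae_eq_integral => //.
  - exact: (measurable_fun_fubini_tonelli_G (m1 := mu) F1).
  - exact: (measurable_fun_fubini_tonelli_G (m1 := mu) F2).
  - by move=> y _; apply: integral_ge0.
  - by move=> y _; apply: integral_ge0.
  exists [set y | eucl_norm y = 0]; split.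
  - rewrite -[X in measurable X]setTI.
    exact: (@measurable_eucl_norm R n.+1 measurableT [set 0] (measurable_set1 _)).
  - exact: lebesgue_euclidean_origin.
  move=> y /=; apply: contra_notP => /eqP ny _.
  have y0 : 0 < eucl_norm y by rewrite lt_neqAle eq_sym ny eucl_norm_ge0.
  rewrite (ge0_integral_lebesgue_scale y0)//; last first.
    apply: (measurableT_comp mF1); exact: measurable_pair2.
  rewrite -ge0_integralZl//.
  - by apply: eq_integral => t _; rewrite /F1 /F2/= EFinM mulrC.
  - apply: (measurableT_comp mF1) => /=.
    by apply: measurable_fun_pair => //; exact: mulrl_measurable.
  - by rewrite lee_fin eucl_norm_ge0.
rewrite -(fubini_tonelli (m1 := mu) (m2 := lebesgue_euclidean R n.+1) F2)//.
transitivity (\int[mu]_t \int[lebesgue_euclidean R n.+1]_y F3 (t, y))%E.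
  apply: eq_integral => t _.
  have ct := cos_atan_gt0 t.
  have mF2t : measurable_fun setT (fun y => F2 (t, y)).
    by apply: (measurableT_comp mF2); exact: measurable_pair1.
  rewrite [LHS](ge0_integral_eucl_scale ct)// -ge0_integralZl//.
  - apply: eq_integral => y _; rewrite /F2 /F3 -EFinM /=; congr EFin.
    rewrite eucl_norm_scale//.
    have := eucl_norm_ge0 y; rewrite le_eqVlt => /predU1P[<-|y0].
      by rewrite !(mulr0, mul0r).
    have [e1 e2] := slice_polar t y0.
    rewrite /H -eucl_norm_scale// e1 e2 [in RHS]exprS.
    rewrite eucl_norm_scale//; ring.
  - exact: (measurableT_comp mF2t (@measurable_eucl_scale R n.+1 _)).
  - by rewrite lee_fin exprn_ge0.
rewrite (fubini_tonelli (m1 := mu) (m2 := lebesgue_euclidean R n.+1) F3)//.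
apply: eq_integral => y _; rewrite -ge0_integralZl//.
- apply/measurable_EFinP.
  have m2 : measurable_fun [set: R] (fun t : R => (t, y)).
    by apply: measurable_fun_pair.
  exact: (measurableT_comp mG m2).
- by move=> t _; rewrite lee_fin mulr_ge0// exprn_ge0.
- by rewrite lee_fin mulr_ge0// eucl_norm_ge0.
Qed.

End slicing.

Section sphere_as_cone.
Local Open Scope classical_set_scope.
Variable R : realType.

Definition unit_profile (r : R) : R := (0 < r <= 1)%R%:R.

Lemma unit_profile_ge0 r : 0 <= unit_profile r.
Proof. exact: ler0n. Qed.

Lemma measurable_unit_profile : measurable_fun setT unit_profile.
Proof.
rewrite (_ : unit_profile = \1_(`]0, 1]%classic : set R)); last first.
  by apply/funext => r; rewrite indicE /unit_profile mem_setE in_itv.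
exact: measurable_indic.
Qed.

Lemma measurable_sphere n : measurable (@sphere R n).
Proof.
rewrite -[X in measurable X]setTI.
exact: (@measurable_eucl_norm R n measurableT [set 1] (measurable_set1 _)).
Qed.

Lemma radial_proj_sphere n (x : euclidean R n) : 0 < eucl_norm x ->
  sphere (radial_proj x).
Proof.
move=> x0; apply: eucl_norm_eq => //.
under eq_bigr do rewrite tnth_mktuple expr_div_n.
by rewrite -mulr_suml -sqr_eucl_norm divff ?expr1n// expf_neq0// gt_eqF.
Qed.

(** The surface measure is the cone measure.  Points outside the punctured ball
are sent to the origin, hence off the sphere, so that one map defined everywhere
has the surface measure as its image on the sphere. *)
Lemma ge0_integral_sphere n (u : euclidean R n -> R) :
  measurable_fun setT u -> (forall x, 0 <= u x) ->
  (\int[@surface_measure R n]_(x in @sphere R n) (u x)%:E =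
   n%:R%:E * \int[lebesgue_euclidean R n]_x
     (unit_profile (eucl_norm x) * u (radial_proj x))%:E)%E.
Proof.
move=> mU u0.
pose psi (x : euclidean R n) :=
  eucl_scale (unit_profile (eucl_norm x)) (radial_proj x).
have mpsi : measurable_fun setT psi.
  apply/measurable_fun_tnthP => i.
  rewrite (_ : _ \o _ = fun x =>
      unit_profile (eucl_norm x) * tnth (radial_proj x) i); last first.
    by apply/funext => x /=; rewrite tnth_mktuple.
  apply: measurable_funM.
    exact: (measurableT_comp measurable_unit_profile (@measurable_eucl_norm R n)).
  exact: (measurableT_comp (measurable_tnth i) (@measurable_radial_proj R n)).
have psi1 x : 0 < eucl_norm x <= 1 -> psi x = radial_proj x.
  move=> x1; apply: eq_from_tnth => i.
  by rewrite tnth_mktuple /unit_profile x1 mul1r.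
have psiS x : sphere (psi x) <-> 0 < eucl_norm x <= 1.
  split=> [|x1]; last first.
    by rewrite psi1//; apply: radial_proj_sphere; case/andP: x1.
  rewrite /sphere/= eucl_norm_scale ?unit_profile_ge0// /unit_profile.
  by case: (boolP (_ < _ <= _)) => //; rewrite mul0r => _ h; have := oner_neq0 R; rewrite -h eqxx.
pose p := measure_function_pushforward__canonical__measure_function_Measure
  (lebesgue_euclidean R n) mpsi.
rewrite (@eq_measure_integral _ _ _ _ (mscale (n%:R%:nng : {nonneg R}) p));
  last first.
  move=> A mA AS; congr (_ * lebesgue_euclidean R n _)%E.
  apply/seteqP; split=> x /=.
    by move=> [Ax x1]; rewrite psi1.
  move=> Ax; have /psiS x1 := AS _ Ax.
  by rewrite -psi1.
rewrite ge0_integral_mscale//; last 3 first.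
- exact: measurable_sphere.
- exact/measurable_funTS/measurable_EFinP.
- by move=> x _; rewrite lee_fin.
congr (_ * _)%E.
rewrite ge0_integral_pushforward//; last 3 first.
- exact: measurable_sphere.
- exact/measurable_funTS/measurable_EFinP.
- by move=> x _; rewrite lee_fin.
rewrite integral_mkcond; apply: eq_integral => x _.
rewrite patchE; case: ifPn => [/set_mem/psiS x1|/negP xS] /=.
  by rewrite psi1// /unit_profile x1 mul1r.
rewrite /unit_profile; case: (boolP (_ < _ <= _)) => [x1|]; last by rewrite mul0r.
by exfalso; apply: xS; apply/mem_set/psiS.
Qed.

End sphere_as_cone.

(** * The bound in even and in odd dimension *)

Section coordinate_bound.
Local Open Scope classical_set_scope.
Variable R : realType.
Let mu := @lebesgue_measure R.

(** What the quadrature needs to know about a form of degree [p].  Arbitrary [a]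
and [b], hence ellipses and segments besides circles, make the property stable
under permutation of the coordinates and under the addition of a dummy
variable. *)
Definition trig_on_circles n p (u : euclidean R n -> R) :=
  forall a b : euclidean R n, trig_poly p
    (fun x => u [tuple sin x * tnth a i + cos x * tnth b i | i < n]).

Lemma trig_slice n p (u : euclidean R n.+1 -> R) (w : euclidean R n) :
  trig_on_circles p u -> trig_poly p (fun x => u (slice x w)).
Proof.
move=> tu.
apply: eq_trig (tu [tuple of 1 :: [tuple 0 | i < n]] [tuple of 0 :: w]) => x.
congr u; apply: eq_from_tnth => i; rewrite tnth_mktuple.
case: (unliftP ord0 i) => [k ->|->].
  by rewrite !tnthS !tnth_mktuple mulr0 add0r.
by rewrite !tnth0 mulr0 mulr1 addr0.
Qed.

Lemma trig_cos_slice n m (u : euclidean R n.+1 -> R) (w : euclidean R n) q :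
  trig_on_circles m.*2 u ->
  trig_poly (m + q).*2 (fun x => cos x ^+ q.*2 * u (slice x w)).
Proof.
move=> tu; rewrite doubleD addnC.
apply: trig_mul; last exact: trig_slice.
have := trig_exp q.*2 (@trig_cos1 R); by rewrite mul1n.
Qed.

Lemma expr_cos_atan p t :
  cos (atan t) ^+ p.+2 = cos (atan t) ^+ p / (1 + t ^+ 2) :> R.
Proof. by rewrite -addn2 exprD cos2_atan. Qed.

Lemma measurable_tnth_sqr n (u : euclidean R n -> R) (j : 'I_n) :
  measurable_fun setT u ->
  measurable_fun setT (fun x : euclidean R n => (tnth x j : R) ^+ 2 * u x).
Proof.
by move=> mU; apply: measurable_funM => //; apply: measurable_funX; exact: measurable_tnth.
Qed.

(** In even dimension the weight left by the slicing is an even power of the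
cosine, and [cos ^+ q.*2.+2] is [cos ^+ q.*2] times the derivative of [atan];
on each slice the claim is then [integral_sin2_atan]. *)
Lemma even_first_coordinate_bound q m (phi : R -> R) (u : euclidean R q.*2.+2 -> R) :
  measurable_fun setT phi -> (forall r, 0 <= phi r) ->
  measurable_fun setT u -> (forall x, 0 <= u x) ->
  trig_on_circles m.*2 u ->
  ((sin (pi / (2 * (m + q).+2%:R)) ^+ 2)%:E *
   \int[lebesgue_euclidean R q.*2.+2]_x
     (phi (eucl_norm x) * u (radial_proj x))%:E <=
   \int[lebesgue_euclidean R q.*2.+2]_x
     (phi (eucl_norm x) * (tnth (radial_proj x) ord0 ^+ 2 * u (radial_proj x)))%:E)%E.
Proof.
move=> mphi phi0 mU u0 tu.
have mU2 := measurable_tnth_sqr ord0 mU.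
have u20 x : 0 <= tnth x ord0 ^+ 2 * u x by rewrite mulr_ge0// sqr_ge0.
rewrite (polar_slicing mphi phi0 mU u0) (polar_slicing mphi phi0 mU2 u20).
set c := sin _ ^+ 2.
have c0 : 0 <= c by exact: sqr_ge0.
have y0 (y : euclidean R q.*2.+1) : 0 <= eucl_norm y * phi (eucl_norm y).
  by rewrite mulr_ge0// eucl_norm_ge0.
have ca t : 0 <= cos (atan t) :> R := ltW (cos_atan_gt0 t).
have mW : measurable_fun setT
    (fun y : euclidean R q.*2.+1 => eucl_norm y * phi (eucl_norm y)).
  apply: measurable_funM; first exact: measurable_eucl_norm.
  exact: (measurableT_comp mphi (@measurable_eucl_norm R _)).
have mI (v : euclidean R q.*2.+2 -> R) : measurable_fun setT v -> (forall x, 0 <= v x) ->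
    measurable_fun setT (fun y : euclidean R q.*2.+1 =>
      (eucl_norm y * phi (eucl_norm y))%:E * \int[mu]_t
        (cos (atan t) ^+ q.*2.+2 * v (slice (atan t) (radial_proj y)))%:E)%E.
  move=> mv v0; apply: emeasurable_funM; first exact/measurable_EFinP.
  exact: measurable_slice_integral.
have I0 (v : euclidean R q.*2.+2 -> R) : (forall x, 0 <= v x) -> forall y,
    (0 <= (eucl_norm y * phi (eucl_norm y))%:E * \int[mu]_t
        (cos (atan t) ^+ q.*2.+2 * v (slice (atan t) (radial_proj y)))%:E)%E.
  move=> v0 y; apply: mule_ge0; first by rewrite lee_fin.
  by apply: integral_ge0 => t _; rewrite lee_fin mulr_ge0// exprn_ge0.
rewrite -ge0_integralZl//;
  [|exact: (mI u mU u0)|by move=> y _; exact: (I0 u u0)].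
apply: ge0_le_integral => //.
- by move=> y _; apply: mule_ge0; [rewrite lee_fin|exact: (I0 u u0)].
- by apply: emeasurable_funM => //; exact: (mI u mU u0).
- exact: (mI _ mU2 u20).
move=> y _; rewrite muleCA lee_wpmul2l// ?lee_fin//.
pose A (x : R) := cos x ^+ q.*2 * u (slice x (radial_proj y)).
have tA : trig_poly (m + q).*2 A by exact: trig_cos_slice.
have A0 x : 0 <= A x by rewrite mulr_ge0// exprn_even_ge0// odd_double.
have := integral_sin2_atan (ltnSn (m + q).+1) tA A0.
congr (_ * _ <= _)%E.
  apply: eq_integral => t _; congr EFin.
  by rewrite expr_cos_atan /A mulrAC.
apply: eq_integral => t _; congr EFin.
by rewrite expr_cos_atan /A tnth0; ring.
Qed.

Lemma eucl_norm_perm n (s : {perm 'I_n}) (x : euclidean R n) :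
  eucl_norm (eucl_perm s x) = eucl_norm x.
Proof.
congr Num.sqrt; under eq_bigr do rewrite tnth_mktuple.
by rewrite [RHS](reindex_inj (@perm_inj _ s)).
Qed.

Lemma radial_proj_perm n (s : {perm 'I_n}) (x : euclidean R n) :
  radial_proj (eucl_perm s x) = eucl_perm s (radial_proj x).
Proof.
by apply: eq_from_tnth => i; rewrite !tnth_mktuple eucl_norm_perm.
Qed.

(** Exchanging two coordinates preserves the measure and moves [j] to the front. *)
Lemma even_coordinate_bound q m (phi : R -> R) (u : euclidean R q.*2.+2 -> R) j :
  measurable_fun setT phi -> (forall r, 0 <= phi r) ->
  measurable_fun setT u -> (forall x, 0 <= u x) ->
  trig_on_circles m.*2 u ->
  ((sin (pi / (2 * (m + q).+2%:R)) ^+ 2)%:E *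
   \int[lebesgue_euclidean R q.*2.+2]_x
     (phi (eucl_norm x) * u (radial_proj x))%:E <=
   \int[lebesgue_euclidean R q.*2.+2]_x
     (phi (eucl_norm x) * (tnth (radial_proj x) j ^+ 2 * u (radial_proj x)))%:E)%E.
Proof.
move=> mphi phi0 mU u0 tu.
have mint (v : euclidean R q.*2.+2 -> R) : measurable_fun setT v ->
    measurable_fun setT (fun x : euclidean R q.*2.+2 =>
      (phi (eucl_norm x) * v (radial_proj x))%:E).
  move=> mv; apply/measurable_EFinP; apply: measurable_funM.
    exact: (measurableT_comp mphi (@measurable_eucl_norm R _)).
  exact: (measurableT_comp mv (@measurable_radial_proj R _)).
pose s := tperm ord0 j.
have tus : trig_on_circles m.*2 (u \o eucl_perm s).
  move=> a b; apply: eq_trig (tu (eucl_perm s a) (eucl_perm s b)) => x.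
  by congr u; apply: eq_from_tnth => i; rewrite !tnth_mktuple.
have mus : measurable_fun setT (u \o eucl_perm s).
  exact: (measurableT_comp mU (@measurable_eucl_perm R _ s)).
have := even_first_coordinate_bound mphi phi0 mus (fun x => u0 _) tus.
congr (_ * _ <= _)%E.
  rewrite [RHS](ge0_integral_eucl_perm s); last 2 first.
  - exact: (mint _ mU).
  - by move=> x; rewrite lee_fin mulr_ge0.
  by apply: eq_integral => x _; rewrite eucl_norm_perm radial_proj_perm.
rewrite [RHS](ge0_integral_eucl_perm s); last 2 first.
- exact: (mint _ (measurable_tnth_sqr j mU)).
- move=> x; rewrite lee_fin; apply: mulr_ge0 => //; apply: mulr_ge0 => //.
  exact: sqr_ge0.
apply: eq_integral => x _; rewrite eucl_norm_perm radial_proj_perm.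
by rewrite [tnth (eucl_perm _ _) _]tnth_mktuple tpermR.
Qed.

End coordinate_bound.

Section odd_dimension.
Local Open Scope classical_set_scope.
Variable R : realType.
Let mu := @lebesgue_measure R.

Lemma integral_cos_atan M : exists2 C : R, 0 < C &
  (\int[mu]_t (cos (atan t) ^+ M.*2.+2)%:E = C%:E)%E.
Proof.
have tA : trig_poly M.*2 (fun x : R => cos x ^+ M.*2).
  by have := trig_exp M.*2 (@trig_cos1 R); rewrite mul1n.
have A0 (x : R) : 0 <= cos x ^+ M.*2 by rewrite exprn_even_ge0// odd_double.
have := integral_trig_poly_atan (leq_addl 1 M.+1) tA A0.
set C := (_ * _) => e; exists C; last first.
  by rewrite -e; apply: eq_integral => t _; rewrite expr_cos_atan.
have p0 := pi_gt0 R.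
rewrite /C mulr_gt0 ?divr_gt0//.
rewrite big_ord_recl ltr_wpDr ?sumr_ge0// exprn_gt0// cos_gt0_pihalf//.
rewrite mulr0 addr0; apply/andP; split.
  by apply: (@lt_trans _ _ 0); [rewrite oppr_lt0 divr_gt0|rewrite divr_gt0].
rewrite ltr_pM2l// ltf_pV2 ?posrE// -natrM ltr_nat; lia.
Qed.

Lemma measurable_cos_atan p : measurable_fun setT
  (fun t : R => (cos (atan t) ^+ p)%:E).
Proof.
apply/measurable_EFinP; apply: measurable_funX.
apply: (measurableT_comp (f := @cos R)).
  by apply: continuous_measurable_fun; exact: continuous_cos.
by apply: continuous_measurable_fun; exact: continuous_atan.
Qed.

(** A dummy variable raises the dimension to an even one.  The profile [1 / r]
there compensates for the factor [r] that slicing along this variable produces.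
The two integrals get multiplied by integrals over [t] of powers of
[cos (atan t)]; the factor with [tnth _ j ^+ 2] has the larger exponent, hence
the smaller integral, and can be dropped. *)
Lemma odd_coordinate_bound q m (u : euclidean R q.*2.+3 -> R) j :
  measurable_fun setT u -> (forall x, 0 <= u x) ->
  trig_on_circles m.*2 u ->
  (forall r x, u (eucl_scale r x) = r ^+ m.*2 * u x) ->
  ((sin (pi / (2 * (m + q.+1).+2%:R)) ^+ 2)%:E *
   \int[lebesgue_euclidean R q.*2.+3]_x
     (unit_profile (eucl_norm x) * u (radial_proj x))%:E <=
   \int[lebesgue_euclidean R q.*2.+3]_x
     (unit_profile (eucl_norm x) *
       (tnth (radial_proj x) j ^+ 2 * u (radial_proj x)))%:E)%E.
Proof.
move=> mU u0 tu hu.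
pose drop1 (x : euclidean R q.*2.+4) : euclidean R q.*2.+3 :=
  [tuple of behead x].
have drop1E x i : tnth (drop1 x) i = tnth x (lift ord0 i).
  by rewrite [x in RHS]tuple_eta tnthS.
pose phi (r : R) := unit_profile r / r.
have phi0 r : 0 <= phi r.
  rewrite /phi /unit_profile; case: (boolP (_ < _ <= _)) => [/andP[r0 _]|_].
    by rewrite divr_ge0// ltW.
  by rewrite mul0r.
have mphi : measurable_fun setT phi.
  rewrite (_ : phi = fun r => unit_profile r * r `^ (-1)); last first.
    apply/funext => r; rewrite /phi /unit_profile.
    case: (boolP (_ < _ <= _)) => [/andP[r0 _]|_]; last by rewrite !mul0r.
    by rewrite powR_inv1// ltW.
  apply: measurable_funM; first exact: measurable_unit_profile.
  exact: measurable_powR.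
have phiE r : r * phi r = unit_profile r.
  rewrite /phi /unit_profile; case: (boolP (_ < _ <= _)) => [/andP[r0 _]|_].
    by rewrite mulrCA mulfV ?mulr1// gt_eqF.
  by rewrite mul0r mulr0.
have mdrop : measurable_fun setT drop1 by exact: measurable_behead.
have mD (v : euclidean R q.*2.+3 -> R) : measurable_fun setT v ->
    measurable_fun setT (v \o drop1) by move=> mv; exact: measurableT_comp.
have drop1_slice a w : drop1 (slice a w) = eucl_scale (cos a) w.
  by apply: eq_from_tnth => i; rewrite drop1E tnthS.
have ca t : 0 <= cos (atan t) :> R := ltW (cos_atan_gt0 t).
(* On a slice the dummy coordinate is [sin], and the others scale by [cos], so
   the integral along the slice factors out of a homogeneous integrand. *)
have key k (v : euclidean R q.*2.+3 -> R) : measurable_fun setT v ->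
    (forall x, 0 <= v x) -> (forall r x, v (eucl_scale r x) = r ^+ k.*2 * v x) ->
    exists2 C : R, 0 < C &
    (\int[mu]_t (cos (atan t) ^+ (k + q.+1).*2.+2)%:E = C%:E)%E /\
    (\int[lebesgue_euclidean R q.*2.+4]_x
       (phi (eucl_norm x) * v (drop1 (radial_proj x)))%:E =
     C%:E * \int[lebesgue_euclidean R q.*2.+3]_x
       (unit_profile (eucl_norm x) * v (radial_proj x))%:E)%E.
  move=> mv v0 hv; have [C C0 eC] := integral_cos_atan (k + q.+1).
  exists C => //; split=> //.
  rewrite (polar_slicing mphi phi0 (mD _ mv) (fun x => v0 _)).
  rewrite -ge0_integralZl//=; last 3 first.
  - apply/measurable_EFinP; apply: measurable_funM.
      exact: (measurableT_comp (@measurable_unit_profile R) (@measurable_eucl_norm R _)).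
    exact: (measurableT_comp mv (@measurable_radial_proj R _)).
  - by move=> x _; rewrite lee_fin mulr_ge0// unit_profile_ge0.
  - by rewrite lee_fin ltW.
  apply: eq_integral => y _; rewrite phiE.
  under eq_integral.
    move=> t _; rewrite drop1_slice hv.
    rewrite (_ : _ * _ = v (radial_proj y) * cos (atan t) ^+ (k + q.+1).*2.+2); last first.
      rewrite mulrA -exprD mulrC; congr (_ * _ ^+ _); lia.
    rewrite EFinM; over.
  rewrite ge0_integralZl//=.
  - by rewrite eC -!EFinM; congr EFin; ring.
  - exact: measurable_cos_atan.
  - by move=> t _; rewrite lee_fin exprn_ge0.
  - by rewrite lee_fin.
have tu' : trig_on_circles m.*2 (u \o drop1).
  move=> a b; apply: eq_trig (tu (drop1 a) (drop1 b)) => x.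
  by congr u; apply: eq_from_tnth => i; rewrite tnth_mktuple !drop1E tnth_mktuple.
have := @even_coordinate_bound R q.+1 m phi (u \o drop1) (lift ord0 j)
   mphi phi0 (mD _ mU) (fun x => u0 _) tu'.
have mU2 := measurable_tnth_sqr j mU.
have u20 x : 0 <= tnth x j ^+ 2 * u x by rewrite mulr_ge0// sqr_ge0.
have hu2 r x : tnth (eucl_scale r x) j ^+ 2 * u (eucl_scale r x) =
    r ^+ m.+1.*2 * (tnth x j ^+ 2 * u x).
  by rewrite tnth_mktuple hu doubleS (exprS r) (exprS r); ring.
have [C C0 [eC ->]] := key m u mU u0 hu.
have [C' C'0 [eC']] := key m.+1 _ mU2 u20 hu2.
have -> : (\int[lebesgue_euclidean R q.*2.+4]_x
    (phi (eucl_norm x) * (tnth (drop1 (radial_proj x)) j ^+ 2 *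
       u (drop1 (radial_proj x))))%:E =
  \int[lebesgue_euclidean R q.+1.*2.+2]_x
     (phi (eucl_norm x) * (tnth (radial_proj x) (lift ord0 j) ^+ 2 *
        (u \o drop1) (radial_proj x)))%:E)%E.
  by apply: eq_integral => x _; rewrite drop1E.
move=> ->; rewrite muleCA => le1.
have CC : C' <= C.
  rewrite -lee_fin -eC -eC'; apply: ge0_le_integral => //.
  - by move=> t _; rewrite lee_fin exprn_ge0.
  - exact: measurable_cos_atan.
  - exact: measurable_cos_atan.
  - move=> t _; rewrite lee_fin; apply: ler_wiXn2l => //; lia.
rewrite -(@lee_pmul2l _ C%:E)// (le_trans le1)//.
apply: lee_wpmul2r; last by rewrite lee_fin.
by apply: integral_ge0 => x _; rewrite lee_fin mulr_ge0// unit_profile_ge0.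
Qed.

End odd_dimension.

(** * Squared modulus of a form *)

Local Open Scope complex_scope.

Section squared_modulus.
Variables (R : realType) (d : nat).
Implicit Types (f : {mpoly R[i][d]}) (x : euclidean R d).

(** Explicit sums over a list of monomials let the real and the imaginary part of
a complex form be indexed by the same support, although each may have fewer
monomials. *)
Definition real_form (c : 'X_{1..d} -> R) (s : seq 'X_{1..d}) x : R :=
  \sum_(e <- s) c e * \prod_(i < d) tnth x i ^+ e i.

Lemma measurable_real_form c s : measurable_fun setT (real_form c s).
Proof.
apply: measurable_sum => e; apply: measurable_funM => //.
apply: measurable_prod => i _; apply: measurable_funX.
exact: measurable_tnth.
Qed.

Lemma real_form_homog c s m r x : {in s, forall e, mdeg e = m} ->
  real_form c s (eucl_scale r x) = r ^+ m * real_form c s x.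
Proof.
move=> sm; rewrite /real_form mulr_sumr big_seq [RHS]big_seq.
apply: eq_bigr => e /sm em.
under eq_bigr do rewrite tnth_mktuple exprMn.
by rewrite big_split/= prodrXr -mdegE em; ring.
Qed.

Lemma trig_real_form c s m : {in s, forall e, mdeg e = m} ->
  trig_on_circles m (real_form c s).
Proof.
move=> sm a b; rewrite /real_form.
suff h : trig_poly m (fun t => \sum_(e <- s | e \in s) c e * \prod_(i < d)
    (sin t * tnth a i + cos t * tnth b i) ^+ e i).
  apply: eq_trig h => t; rewrite [RHS]big_seq; apply: eq_bigr => e _.
  by congr (_ * _); apply: eq_bigr => i _; rewrite tnth_mktuple.
apply: trig_sum => e /sm <-; apply: trig_scale; rewrite mdegE.
apply: trig_prod => i.
suff h : trig_poly 1 (fun t => sin t * tnth a i + cos t * tnth b i).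
  by have := trig_exp (e i) h; rewrite mul1n.
apply: trig_add.
  by apply: eq_trig (trig_scale (tnth a i) (@trig_sin1 R)) => t; rewrite mulrC.
by apply: eq_trig (trig_scale (tnth b i) (@trig_cos1 R)) => t; rewrite mulrC.
Qed.

Lemma poly_funE f x : poly_fun f x =
  Complex (real_form (fun e => complex.Re f@_e) (msupp f) x)
          (real_form (fun e => complex.Im f@_e) (msupp f) x).
Proof.
rewrite /poly_fun mevalE /real_form.
elim: (msupp f : seq _) => [|e s IH]; first by rewrite !big_nil.
rewrite !big_cons IH.
have -> : \prod_(i < d) (tnth x i)%:C ^+ e i = (\prod_(i < d) tnth x i ^+ e i)%:C.
  by rewrite rmorph_prod; apply: eq_bigr => i _; rewrite rmorphXn.
by case: (f@_e) => a b /=; simpc.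
Qed.

Definition sqr_modulus f x : R :=
  complex.Re (poly_fun f x) ^+ 2 + complex.Im (poly_fun f x) ^+ 2.

Lemma sqr_modulus_ge0 f x : 0 <= sqr_modulus f x.
Proof. by rewrite addr_ge0// sqr_ge0. Qed.


Lemma measurable_sqr_modulus f : measurable_fun setT (sqr_modulus f).
Proof.
rewrite (_ : sqr_modulus f = fun x =>
    real_form (fun e => complex.Re f@_e) (msupp f) x ^+ 2 +
    real_form (fun e => complex.Im f@_e) (msupp f) x ^+ 2); last first.
  by apply/funext => x; rewrite /sqr_modulus poly_funE.
by apply: measurable_funD; apply: measurable_funX; exact: measurable_real_form.
Qed.

Lemma sqr_modulus_homog f m r x : f \is m.-homog ->
  sqr_modulus f (eucl_scale r x) = r ^+ m.*2 * sqr_modulus f x.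
Proof.
move=> /dhomogP hf; rewrite /sqr_modulus !poly_funE /=.
by rewrite !(real_form_homog _ _ _ hf) !exprMn -mulrDr -exprM muln2.
Qed.

Lemma trig_sqr_modulus f m : f \is m.-homog ->
  trig_on_circles m.*2 (sqr_modulus f).
Proof.
move=> /dhomogP hf a b; rewrite -muln2.
apply: eq_trig (trig_add
  (trig_exp 2 (trig_real_form (fun e => complex.Re f@_e) hf a b))
  (trig_exp 2 (trig_real_form (fun e => complex.Im f@_e) hf a b))) => t.
by rewrite /sqr_modulus !poly_funE.
Qed.

End squared_modulus.

Section coordinate_bound_sphere.
Variable R : realType.

Lemma coordinate_bound n m (u : euclidean R n.+2 -> R) j :
  measurable_fun setT u -> (forall x, 0 <= u x) ->
  trig_on_circles m.*2 u ->
  (forall r x, u (eucl_scale r x) = r ^+ m.*2 * u x) ->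
  ((sin (pi / (2 * (m + uphalf n).+2%:R)) ^+ 2)%:E *
   \int[lebesgue_euclidean R n.+2]_x
     (unit_profile (eucl_norm x) * u (radial_proj x))%:E <=
   \int[lebesgue_euclidean R n.+2]_x
     (unit_profile (eucl_norm x) *
       (tnth (radial_proj x) j ^+ 2 * u (radial_proj x)))%:E)%E.
Proof.
have [[] [q nq]] : exists b : bool, exists q, n = (b + q.*2)%N.
- by exists (odd n), n./2; rewrite odd_double_half.
- subst n => mU u0 tu hu; rewrite (_ : uphalf _ = q.+1); last lia.
  exact: odd_coordinate_bound.
subst n => mU u0 tu _; rewrite (_ : uphalf _ = q); last lia.
apply: even_coordinate_bound => //; first exact: measurable_unit_profile.
Qed.

(** The real-valued integral is [0] when the extended one is infinite, so no
finiteness of the surface measure has to be established: the integral with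
[tnth x j ^+ 2] is dominated by the other one. *)
Lemma sphere_coordinate_bound n m (u : euclidean R n.+2 -> R) j :
  measurable_fun setT u -> (forall x, 0 <= u x) ->
  trig_on_circles m.*2 u ->
  (forall r x, u (eucl_scale r x) = r ^+ m.*2 * u x) ->
  (pi ^+ 2 / (4 * (m + 2 * n.+2 + 1)%:R ^+ 2)) *
   \int[@surface_measure R n.+2]_(x in @sphere R n.+2) u x <=
   \int[@surface_measure R n.+2]_(x in @sphere R n.+2) (tnth x j ^+ 2 * u x).
Proof.
move=> mU u0 tu hu.
have mU2 := measurable_tnth_sqr j mU.
have u20 x : 0 <= tnth x j ^+ 2 * u x by rewrite mulr_ge0// sqr_ge0.
set c := _ / _.
have c0 : 0 <= c by rewrite divr_ge0 ?sqr_ge0// mulr_ge0// sqr_ge0.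
pose I := (\int[@surface_measure R n.+2]_(x in @sphere R n.+2) (u x)%:E)%E.
pose J := (\int[@surface_measure R n.+2]_(x in @sphere R n.+2)
  (tnth x j ^+ 2 * u x)%:E)%E.
have I0 : (0 <= I)%E by apply: integral_ge0 => x _; rewrite lee_fin.
have J0 : (0 <= J)%E by apply: integral_ge0 => x _; rewrite lee_fin.
have JI : (J <= I)%E.
  apply: ge0_le_integral => //.
  - exact: measurable_sphere.
  - by move=> x _; rewrite lee_fin.
  - exact/measurable_funTS/measurable_EFinP.
  - exact/measurable_funTS/measurable_EFinP.
  move=> x Sx; rewrite lee_fin ler_piMl//.
  have <- : eucl_norm x ^+ 2 = 1 by rewrite Sx expr1n.
  rewrite sqr_eucl_norm (bigD1 j)//= lerDl sumr_ge0// => i _.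
  exact: sqr_ge0.
have cIJ : (c%:E * I <= J)%E.
  rewrite /I /J (ge0_integral_sphere mU u0) (ge0_integral_sphere mU2 u20).
  rewrite muleCA; apply: lee_wpmul2l; first by rewrite lee_fin.
  apply: le_trans (coordinate_bound j mU u0 tu hu).
  apply: lee_wpmul2r.
    apply: integral_ge0 => x _.
    by rewrite lee_fin mulr_ge0// unit_profile_ge0.
  have cE : c = (pi / (2 * (m + 2 * n.+2 + 1)%:R)) ^+ 2.
    by rewrite expr_div_n exprMn -natrX.
  rewrite lee_fin cE ler_sqr ?nnegrE.
  - apply: sin_first_node; lia.
  - by rewrite divr_ge0 ?pi_ge0// mulr_ge0.
  - apply: (@le_trans _ _ (pi / (2 * (m + 2 * n.+2 + 1)%:R))).
      by rewrite divr_ge0 ?pi_ge0// mulr_ge0.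
    apply: sin_first_node; lia.
rewrite /Rintegral -/I -/J.
move: I0 J0 JI cIJ; case: I => [a||]; case: J => [b||] //=.
- by move=> _ J0 _ _; rewrite mulr0.
- by rewrite mulr0.
Qed.

End coordinate_bound_sphere.

Theorem theorem3 (R : realType) (d : nat) (hd : (2 <= d)%N) (m : nat)
    (f : {mpoly R[i][d]}) (hf : f \is m.-homog) (j : 'I_d) :
  sphere_inner (fun x => (tnth x j ^+ 2)%:C * poly_fun f x) (poly_fun f) >=
  (pi ^+ 2 / (4 * (m + 2 * d + 1)%:R ^+ 2))%:C *
    sphere_inner (poly_fun f) (poly_fun f).
Proof.
have inner2 x : poly_fun f x * (poly_fun f x)^* = (sqr_modulus f x)%:C.
  rewrite /sqr_modulus; case: (poly_fun f x) => a b /=; simpc.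
  by congr Complex; ring.
have realI (u : euclidean R d -> R) :
    sphere_integral (fun x => (u x)%:C) =
    (\int[@surface_measure R d]_(x in @sphere R d) u x)%:C.
  rewrite /sphere_integral /=; congr Complex.
  by rewrite /Rintegral integral0.
have -> : sphere_inner (poly_fun f) (poly_fun f) =
    sphere_integral (fun x => (sqr_modulus f x)%:C).
  by congr sphere_integral; apply/funext => x; exact: inner2.
have -> : sphere_inner (fun x => (tnth x j ^+ 2)%:C * poly_fun f x) (poly_fun f) =
    sphere_integral (fun x => (tnth x j ^+ 2 * sqr_modulus f x)%:C).
  congr sphere_integral; apply/funext => x.
  by rewrite -mulrA inner2 -rmorphM.
rewrite !realI -rmorphM lecR.
case: d hd f hf j {inner2 realI} => [|[|n]] // _ f hf j.
apply: sphere_coordinate_bound.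
- exact: measurable_sqr_modulus.
- exact: sqr_modulus_ge0.
- exact: trig_sqr_modulus.
- by move=> r x; exact: sqr_modulus_homog.
Qed.
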